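(* Let $L$ be an $n$-dimensional simplicial complex having $N$ simplices in total ($N$ finite), such that every simplex of $L$ is a face of an $n$-simplex and $|L|-|L^{n-2}|$ is connected, where $L^{n-2}$ is the $(n-2)$-skeleton of $L$. If $(\Gamma,V)$ is a right-angled Coxeter system such that $K(\Gamma,V)$ is the barycentric subdivision of $L$, then $\Gamma$ has a torsion-free normal subgroup $\Gamma_1$ of index $2^{n+1}$, which may be generated by $N-n-1$ elements. Moreover, $\Gamma$ has no torsion-free subgroups of lower index, and any normal subgroup of $\Gamma$ of index $2^{n+1}$ requires at least $N-n-1$ generators.
   Context: A right-angled Coxeter system $(\Gamma,V)$ is a group $\Gamma$ with a generating set $V$ such that $\Gamma$ has a presentation $\langle V\mid (vw)^{m(v,w)}=1\ (v,w\in V)\rangle$, where $m(v,v)=1$ and, for $v\ne w$, $m(v,w)=m(w,v)\in\{2,\infty\}$ (relation omitted when $m=\infty$). $K(\Gamma,V)$ is the simplicial complex whose $n$-simplices are the $(n+1)$-element subsets of $V$ generating finite subgroups of $\Gamma$. $|L|$ denotes topological realisation; simplices are non-empty. *)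

(* Defs.v *)
From HB Require Import structures.
From mathcomp Require Import all_boot all_order all_algebra finmap.
From mathcomp Require Import all_classical all_reals all_analysis.

Set Implicit Arguments.
Unset Strict Implicit.
Unset Printing Implicit Defensive.

Import Order.TTheory GRing.Theory Num.Theory.
Import numFieldNormedType.Exports.

Local Open Scope classical_set_scope.
Local Open Scope card_scope.
Local Open Scope ring_scope.

(* Subgroups of a possibly infinite group [G] are sets [H : set G]. *)
Section Groups.
Context {G : groupType}.
Implicit Types (H S : set G).
Local Open Scope group_scope.

Definition is_subgroup H : Prop := group_closed (mem H).

Definition is_normal_subgroup H : Prop :=
  is_subgroup H /\ forall x y : G, H x -> H (x ^ y).

Definition generated S : set G := smallest is_subgroup S.

(* Repetitions are allowed in the tuple, so this reads "at most [k]". *)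
Definition generated_by H (k : nat) : Prop :=
  exists s : k.-tuple G, H = generated [set` s].

Definition torsion_free H : Prop :=
  forall (x : G) (k : nat), H x -> (0 < k)%N -> x ^+ k = 1 -> x = 1.

Definition left_cosets H : set (set G) :=
  [set [set x * y | y in H] | x in [set: G]].

Definition has_index H (k : nat) : Prop := left_cosets H #= `I_k.

End Groups.

(* Words in the letters [i] and [i^-1] for [i : I]: the letter [(i, true)]
   stands for [i] and [(i, false)] for [i^-1]. *)
Definition word (I : Type) : Type := seq (I * bool).

(* Equality of words in the quotient of the free group on [I] by the normal
   closure of [R]. *)
Inductive word_eq (I : Type) (R : set (word I)) : word I -> word I -> Prop :=
| word_eq_refl w : word_eq R w w
| word_eq_sym w1 w2 : word_eq R w1 w2 -> word_eq R w2 w1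
| word_eq_trans w1 w2 w3 :
    word_eq R w1 w2 -> word_eq R w2 w3 -> word_eq R w1 w3
| word_eq_cancel u v (i : I) (b : bool) :
    word_eq R (u ++ [:: (i, b); (i, ~~ b)] ++ v) (u ++ v)
| word_eq_relator u v r : R r -> word_eq R (u ++ r ++ v) (u ++ v).

Section Coxeter.
Context {G : groupType}.
Local Open Scope group_scope.

Definition word_eval (I : Type) (g : I -> G) (w : word I) : G :=
  \prod_(l <- w) (if l.2 then g l.1 else (g l.1)^-1).

(* [G] has the presentation < I | R >, the generator [i] being [g i]. *)
Definition has_presentation (I : Type) (g : I -> G) (R : set (word I)) : Prop :=
  (forall x : G, exists w : word I, word_eval g w = x) /\
  (forall w1 w2 : word I,
     word_eval g w1 = word_eval g w2 <-> word_eq R w1 w2).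

(* [None] stands for [m(v, w)] infinite. *)
Definition right_angled_matrix (I : Type) (m : I -> I -> option nat) : Prop :=
  (forall v, m v v = Some 1%N) /\
  (forall v w, v <> w ->
     m v w = m w v /\ (m v w = Some 2%N \/ m v w = None)).

Definition coxeter_relators (I : Type) (m : I -> I -> option nat) :
    set (word I) :=
  [set r | exists v w k,
     m v w = Some k /\ r = flatten (nseq k [:: (v, true); (w, true)])].

Definition right_angled_coxeter_system (V : set G) : Prop :=
  exists m : V -> V -> option nat,
    right_angled_matrix m /\
    has_presentation (fun v : V => \val v) (coxeter_relators m).

(* The complex K(G, V). *)
Definition coxeter_complex (V : set G) : set {fset G} :=
  [set s | [/\ s != fset0, [set` s] `<=` V & finite_set (generated [set` s])]].

End Coxeter.

(* A simplicial complex is given by its set of (non-empty) simplices, each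
   identified with its finite set of vertices. *)
Section Complexes.
Context {T : choiceType}.
Implicit Types (L : set {fset T}) (s t : {fset T}).

Definition is_simplicial_complex L : Prop :=
  (forall s, L s -> s != fset0) /\
  (forall s t, L s -> t != fset0 -> (t `<=` s)%fset -> L t).

Definition vertices L : set T := [set x | L [fset x]%fset].

Definition simplex_dim s : int := (#|` s|)%:Z - 1.

Definition has_dimension L (n : int) : Prop :=
  (exists2 s, L s & simplex_dim s = n) /\
  (forall s, L s -> simplex_dim s <= n).

Definition skeleton L (k : int) : set {fset T} :=
  [set s | L s /\ simplex_dim s <= k].

(* Its vertices are the simplices of [L], its simplices the non-empty finite
   chains of simplices of [L]. *)
Definition barycentric_subdivision L : set {fset {fset T}} :=
  [set c | [/\ c != fset0, [set` c] `<=` L &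
     forall s t, s \in c -> t \in c -> (s `<=` t)%fset \/ (t `<=` s)%fset]].

(* Points are given by barycentric coordinates. The topology is that of
   pointwise convergence of coordinates, which is the usual (coherent) topology
   when the complex is finite. *)
Definition realisation (R : realType) L : set {ptws T -> R} :=
  [set p | (forall x, 0 <= p x) /\
     exists2 s, L s &
       (forall x, x \notin s -> p x = 0) /\ \sum_(x <- s) p x = 1].

End Complexes.

Arguments realisation {T} R L.

Definition isomorphic_complexes (S T : choiceType)
    (K : set {fset S}) (L : set {fset T}) : Prop :=
  exists f : S -> T,
    set_bij (vertices K) (vertices L) f /\
    forall A : {fset S}, [set` A] `<=` vertices K ->
      (K A <-> L [fset f x | x in A]%fset).

(* Main.v *)
Require Import Defs.
From HB Require Import structures.
From mathcomp Require Import all_boot all_order all_algebra finmap.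
From mathcomp Require Import zify lra.
From mathcomp Require Import all_classical all_reals all_analysis.

Set Implicit Arguments.
Unset Strict Implicit.
Unset Printing Implicit Defensive.

Import Order.TTheory GRing.Theory Num.Theory.
Import numFieldNormedType.Exports.

Local Open Scope classical_set_scope.
Local Open Scope card_scope.
Local Open Scope ring_scope.

(** [G] has one generator for each simplex of [L], and two of them commute exactly when one
    simplex is a face of the other. The proof has four parts.

    Torsion. Every element of finite order is conjugate to a product of distinct, pairwise
    commuting generators ([torsion_conjugate_clique]). This rests on a word criterion: a
    non-empty word that represents 1 has a factor [s U s] with [s] commuting with all of [U]
    ([trivial_word_cancels]). The criterion is read off from an action of [G] on integer
    labellings of the generators, the numbers game: firing [s] negates its label and pushes
    twice that label onto the generators that do not commute with [s]. As long as only
    positive labels are fired, the negative labels are those of the letters that can be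
    commuted past all letters fired after them, so a negative label can only be fired by a
    cancelling pair. Applied to the powers of a word of finite order, the criterion shows
    that the word is not shortest in its conjugacy class unless its letters commute pairwise.

    Index. Sending the generator of a simplex to the basis vector of its dimension is a
    homomorphism onto [F_2 ^ (n + 1)]. Pairwise commuting generators form a chain of
    simplices, hence have distinct dimensions, so the kernel [G1] is torsion-free. On the
    other hand a maximal flag generates a finite subgroup of order [2 ^ (n + 1)], which meets
    a torsion-free subgroup trivially and so injects into its cosets.

    Generators of [G1]. If two maximal flags differ only in dimension [i], with members [s]
    and [u] there, then each member of these flags centralises or inverts [s u]. Walking
    along galleries of flags and adding the element [s u] whenever a new simplex [u] is met
    gives subgroups normalised by all simplices met so far ([type_normal_step]); once the [N]
    simplices are exhausted, [N - n - 1] elements have been added and the subgroup is [G1]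
    ([parity_kernel_generated]). Galleries reach every simplex: a point off the
    (n-2)-skeleton that belongs to two distinct n-simplices belongs to a common
    (n-1)-face, so a family of n-simplices closed under adjacency along (n-1)-faces cuts
    the connected space [|L| - |L^(n-2)|] in two closed pieces ([strongly_connected]);
    inside one simplex the flags are the orderings of its vertices, and adjacent
    transpositions generate all permutations.

    Number of generators. [G] maps onto [F_2 ^ N] by the parities of all generators. A
    subgroup with [k] generators has an image of at most [2 ^ k] elements, so its index is at
    least [2 ^ (N - k)] ([leq_rank_index]). *)

(** * Presentations and words *)

Section RightAngled.
Context {G : groupType} {I : eqType}.
Local Open Scope group_scope.

Definition word_prod (g : I -> G) (s : seq I) : G := \prod_(v <- s) g v.

(** The form in which the presentation is used: [c v w] stands for [v] and [w] being
    equal or commuting, and the last field is the universal property for actions on sets. *)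
Record right_angled_presentation (c : rel I) (g : I -> G) : Prop := {
  compat_refl : reflexive c;
  compat_sym : symmetric c;
  gen_involution : forall v, g v * g v = 1;
  gen_commute : forall v w, c v w -> g v * g w = g w * g v;
  word_prod_surjective : forall x, exists s, word_prod g s = x;
  action_of_presentation : forall (X : Type) (phi : I -> X -> X),
    (forall v x, phi v (phi v x) = x) ->
    (forall v w x, c v w -> phi v (phi w x) = phi w (phi v x)) ->
    forall s t x, word_prod g s = word_prod g t -> foldr phi x s = foldr phi x t }.

Lemma word_prod_cat (g : I -> G) s t : word_prod g (s ++ t) = word_prod g s * word_prod g t.
Proof. by rewrite /word_prod big_cat. Qed.

Lemma word_prod_cons (g : I -> G) v s : word_prod g (v :: s) = g v * word_prod g s.
Proof. by rewrite /word_prod big_cons. Qed.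

Lemma word_prod1 (g : I -> G) v : word_prod g [:: v] = g v.
Proof. by rewrite /word_prod big_seq1. Qed.

Section GeneratorIdentities.
Variables (c : rel I) (g : I -> G).
Hypothesis P : right_angled_presentation c g.

Lemma gen_inv v : (g v)^-1 = g v.
Proof. by apply: (@mulgI _ (g v)); rewrite mulgV (gen_involution P). Qed.

Lemma gen_mulK v x : g v * (g v * x) = x.
Proof. by rewrite mulgA (gen_involution P) mul1g. Qed.

Lemma gen_commute_word s U :
  all (c s) U -> g s * word_prod g U = word_prod g U * g s.
Proof.
elim: U => [|v U IH] /=; first by rewrite /word_prod big_nil mulg1 mul1g.
move=> /andP[csv /IH e]; rewrite word_prod_cons mulgA (gen_commute P csv).
by rewrite -mulgA e mulgA.
Qed.

End GeneratorIdentities.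

End RightAngled.

Lemma right_angled_presentationP (G : groupType) (V : set G) :
  right_angled_coxeter_system V ->
  exists c : rel V,
    right_angled_presentation c (fun v : V => \val v).
Proof.
move=> [m [[mvv mvw] [ev_onto ev_eq]]].
exists (fun v w => m v w != None).
have relE v w k : m v w = Some k ->
    word_eval (fun v : V => \val v)
      (flatten (nseq k [:: (v, true); (w, true)])) = 1%g.
  move=> mk; suff -> : 1%g = word_eval (fun v : V => \val v) [::].
    apply/ev_eq; rewrite -[X in word_eq _ X _]cats0.
    by apply: (@word_eq_relator _ _ [::] [::]); exists v, w, k.
  by rewrite /word_eval big_nil.
have inv (v : V) : (\val v * \val v)%g = 1%g :> G.
  by have := relE v v 1%N (mvv v); rewrite /word_eval /= !big_cons big_nil mulg1.
have symm (v w : V) : (m v w != None) = (m w v != None).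
  by case: (eqVneq v w) => [-> //|/eqP vw]; case: (mvw v w vw) => ->.
split => //.
- by move=> v; rewrite mvv.
- move=> v w; case: (eqVneq v w) => [-> //|/eqP vw].
  case: (mvw v w vw) => _ [mk|-> //] _.
  have := relE v w 2%N mk.
  rewrite /word_eval /= !big_cons big_nil mulg1 /= => e.
  have iv (u : V) : ((\val u)^-1 = \val u :> G)%g.
    by apply: (@mulgI _ (\val u)); rewrite mulgV inv.
  rewrite -[in RHS](iv v) -[in RHS](iv w) -invgM.
  by apply: (@mulgI _ (\val v * \val w)%g); rewrite mulgV -mulgA.
- move=> x; have [w <-] := ev_onto x.
  exists (map fst w); rewrite /word_prod /word_eval big_map.
  apply: eq_bigr => -[v []] _ //=.
  by apply: (@mulgI _ (\val v)); rewrite mulgV inv.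
- move=> X phi phiK phiC s t x.
  pose up := map (fun v : V => (v, true)).
  have upE u : word_prod (fun v : V => \val v) u = word_eval (fun v : V => \val v) (up u).
    by rewrite /word_prod /word_eval big_map.
  pose act := foldr (fun l : V * bool => phi l.1).
  have actE u y : foldr phi y u = act y (up u) by elim: u => //= v u ->.
  rewrite !upE => /ev_eq; rewrite !actE.
  elim=> //= [u v w _ -> _ -> //|u v i b|u v r [v1 [v2 [k [mk ->]]]]].
    by rewrite /act !foldr_cat /= phiK.
  rewrite /act foldr_cat [in RHS]foldr_cat foldr_cat; congr foldr.
  set y := foldr _ x v.
  case: (eqVneq v1 v2) => [e|/eqP ne].
    by move: mk; rewrite e mvv => -[<-] /=; rewrite phiK.
  case: (mvw _ _ ne) => _ []; rewrite mk // => -[->] /=.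
  by rewrite (phiC v1) ?mk // !phiK.
Qed.

(** * The numbers game *)

Section NumbersGame.
Variables (I : eqType) (c : rel I).
Hypotheses (c_refl : reflexive c) (c_sym : symmetric c).

(** The contragredient of the geometric representation, in the coordinates given by the simple
    roots: [l t] is the value of a linear form at the root of [t], and [s] maps that root to
    itself plus twice the root of [s] when the two generators do not commute. *)
Definition fire (s : I) (l : I -> int) : I -> int :=
  fun t => if t == s then - l s else if c s t then l t else l t + l s *+ 2.

Lemma fireK s l : fire s (fire s l) = l.
Proof.
apply/funext => t; rewrite /fire !eqxx.
case: eqVneq => [->|_]; first by rewrite opprK.
by case: (c s t) => //; rewrite mulNrn addrK.
Qed.

Lemma fireC s t l : c s t -> fire s (fire t l) = fire t (fire s l).
Proof.
move=> cst; apply/funext => u; rewrite /fire.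
case: (eqVneq s t) => [-> //|st].
case: (eqVneq u s) => [->|us]; first by rewrite (negPf st) c_sym cst.
case: (eqVneq u t) => [->|ut]; first by rewrite cst.
rewrite [c t s]c_sym cst.
by case: (c t u); case: (c s u) => //; rewrite addrAC.
Qed.

(** The strict inequality keeps the game going: firing [s] with positive label [l s] then
    makes the label [l t + 2 * l s] of a negative neighbour [t] larger than [l s]. *)
Definition balanced (l : I -> int) : Prop :=
  forall t, l t != 0 /\ forall s, l t < 0 -> ~~ c s t -> - l t < l s.

Lemma fire_balanced s l : balanced l -> 0 < l s -> balanced (fire s l).
Proof.
move=> bal ls t; rewrite /fire.
have [lt0 lneg] := bal t.
case: (eqVneq t s) => [-> |ts].
  split=> [|u _]; first by rewrite oppr_eq0 gt_eqF.
  case: (eqVneq u s) => [->|us]; first by rewrite c_refl.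
  rewrite c_sym => csu; rewrite (negPf csu).
  have [lu0 lneg'] := bal u.
  by have := lneg' s; rewrite csu => /(_ _ isT); lia.
case: (boolP (c s t)) => cst.
  split=> // u ltneg cut; have := lneg u ltneg cut.
  case: (eqVneq u s) => [us|us]; first by move: cut; rewrite us cst.
  by case: ifP => // _; lia.
have := lneg s; rewrite cst => /(_ _ isT) h.
by split=> [|u]; lia.
Qed.

Definition cancels (w : seq I) : Prop :=
  exists s A U B, w = A ++ s :: U ++ s :: B /\ all (c s) U.

(** Words are fired from right to left. A negative label marks a generator that can be
    commuted to the front of the word, so firing it once more exhibits a cancelling pair;
    firing a positive label keeps the labelling balanced. *)
Lemma numbers_game (w : seq I) (l0 := fun _ : I => 1 : int) (l := foldr fire l0 w) :
  cancels w \/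
  [/\ balanced l,
      forall s, l s < 0 -> exists U B, w = U ++ s :: B /\ all (c s) U
    & w = [::] \/ exists s, l s < 0].
Proof.
rewrite {}/l; elim: w => [|v w [IH|[bal avail _]]].
- by right; split=> //; left.
- by left; have [s [A [U [B [-> cU]]]]] := IH; exists s, (v :: A), U, B.
rewrite /=; set l := foldr fire l0 w in bal avail *.
have [lv0 _] := bal v.
move: lv0; rewrite neq_lt => /orP[ln|lp].
  by left; have [U [B [-> cU]]] := avail v ln; exists v, [::], U, B.
right; split; first exact: fire_balanced.
- move=> s; rewrite /fire; case: (eqVneq s v) => [-> _|sv]; first by exists [::], w.
  have [cvs ls|cvs] := ifP.
    have [U [B [-> cU]]] := avail s ls.
    by exists (v :: U), B; rewrite /= c_sym cvs.
  have [ls0 lneg] := bal s; have := lneg v; rewrite cvs => /(_ _ isT).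
  lia.
- by right; exists v; rewrite /fire eqxx; lia.
Qed.

Lemma trivial_game_cancels w (l0 := fun _ : I => 1 : int) :
  foldr fire l0 w = l0 -> w = [::] \/ cancels w.
Proof.
have [|[_ _ [|[s]]]] := numbers_game w; [by right|by left|].
by move=> ls e; move: ls; rewrite e.
Qed.

End NumbersGame.

(** * Elements of finite order *)

Lemma cat_eq_cat_cons (T : Type) (X Y P Q : seq T) (s : T) :
  X ++ Y = P ++ s :: Q ->
  (exists2 M, X = P ++ s :: M & M ++ Y = Q) \/
  (exists2 M, P = X ++ M & Y = M ++ s :: Q).
Proof.
elim: X P => [|x X IH] [|p P] /=.
- by move=> ->; right; exists [::].
- by move=> ->; right; exists (p :: P).
- by move=> [-> <-]; left; exists X.
- move=> [-> /IH [[M -> <-]|[M -> ->]]]; [left|right]; by exists M.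
Qed.

Lemma filter_eq_cat_cons (T : Type) (W : pred T) (w P Q : seq T) (s : T) :
  seq.filter W w = P ++ s :: Q ->
  exists P' Q', [/\ w = P' ++ s :: Q', seq.filter W P' = P & seq.filter W Q' = Q].
Proof.
elim: w P => [|v w IH] P /=; first by case: P.
case: ifP => Wv; last first.
  by move=> /IH [P' [Q' [-> PE QE]]]; exists (v :: P'), Q'; rewrite /= Wv.
case: P => [|p P] /= [<- e]; first by exists [::], w.
have [P' [Q' [-> PE QE]]] := IH _ e; exists (v :: P'), Q'; split=> //=.
by rewrite Wv PE.
Qed.

Lemma not_uniq_repeats (T : eqType) (w : seq T) :
  ~~ uniq w -> exists s A U B, w = A ++ s :: U ++ s :: B.
Proof.
elim: w => //= v w IH; rewrite negb_and negbK => /orP[|/IH].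
  by case/splitPr => U B; exists v, [::], U, B.
by move=> [s [A [U [B ->]]]]; exists s, (v :: A), U, B.
Qed.

Section Torsion.
Context {G : groupType} {I : eqType}.
Variables (c : rel I) (g : I -> G).
Hypothesis P : right_angled_presentation c g.
Let c_refl := compat_refl P.
Let c_sym := compat_sym P.
Local Open Scope group_scope.

(** Restricting to the letters in [W] costs nothing: letting the letters outside [W] act
    trivially is still an action of the group. *)
Lemma trivial_word_cancels (W : pred I) (w : seq I) :
  word_prod g w = 1 -> seq.filter W w = [::] \/ cancels c (seq.filter W w).
Proof.
move=> w1; apply: (trivial_game_cancels c_refl c_sym).
pose phi s l := if W s then fire c s l else l.
have phiE l u : foldr phi l u = foldr (fire c) l (seq.filter W u).
  by elim: u => //= v u ->; rewrite /phi; case: ifP.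
rewrite -phiE.
apply: (@action_of_presentation _ _ _ _ P _ phi _ _ w [::]);
  last by rewrite w1 /word_prod big_nil.
- by move=> v x; rewrite /phi; case: (W v); rewrite ?fireK.
- move=> v u x cvu; rewrite /phi; case: (W v); case: (W u) => //.
  exact: fireC.
Qed.

(** Either way [w] is conjugate to a shorter word: in the second case the two occurrences of
    [s] meet after a cyclic rotation. *)
Definition cyclically_cancels (w : seq I) : Prop :=
  exists s A U B, w = A ++ s :: U ++ s :: B /\
    (all (c s) U \/ all (c s) A /\ all (c s) B).

(** The letter [t] prevents a whole copy of [w] from fitting between the two cancelling
    occurrences of [s]. They lie in one copy of [w], or in two successive ones; in the latter
    case they cannot be the same position of [w], again because of [t]. *)
Lemma power_cyclically_cancels (w : seq I) k s t A U B :
  flatten (nseq k w) = A ++ s :: U ++ s :: B -> all (c s) U ->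
  t \in w -> ~~ c s t -> cyclically_cancels w.
Proof.
move=> e cU tw cst.
have not_all : ~~ all (c s) w by apply/negP => /allP /(_ _ tw); apply/negP.
elim: k A e => [|k IH] A e; first by case: A e.
have [[M wE e']|[M _ e']] := @cat_eq_cat_cons _ w _ _ _ _ e; last exact: IH e'.
have [[M' ME _]|[U' UE e'']] := cat_eq_cat_cons e'.
  by exists s, A, U, M'; split; [rewrite wE ME|left].
move: cU; rewrite UE all_cat => /andP[cM cU'].
case: k {IH e e'} e'' => [|k] e''; first by case: (U') e''.
have [[N wE' _]|[N U'E _]] := @cat_eq_cat_cons _ w _ _ _ _ e''; last first.
  by move: cU' not_all; rewrite U'E all_cat => /andP[->].
have [[K AE KE]|[K U'E _]] := cat_eq_cat_cons (etrans (esym wE) wE'); last first.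
  move: not_all; rewrite wE all_cat /= c_refl cM andbT.
  by move: cU'; rewrite U'E all_cat => /andP[->].
exists s, U', K, M; split; last by right.
by rewrite wE AE -catA.
Qed.

(** The letters of [w] that commute with all of [w] cancel in powers of [w] without telling
    anything about [w], so only the other letters, those in [W], are kept before cancelling. *)
Lemma torsion_word_cancels_or_clique (w : seq I) k : (0 < k)%N -> word_prod g w ^+ k = 1 ->
  cyclically_cancels w \/ uniq w /\ {in w &, forall u v, c u v}.
Proof.
move=> k0 wk.
pose W v := has (fun t => ~~ c v t) w.
have nW v t : ~~ W v -> t \in w -> c v t.
  by move=> /hasPn h /h /negPn.
have powE : word_prod g (flatten (nseq k w)) = 1.
  rewrite -wk; elim: (k) => [|j IH] /=; first by rewrite /word_prod big_nil.
  by rewrite word_prod_cat IH expgS.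
have inpow v : v \in flatten (nseq k w) -> v \in w.
  by move=> /flattenP[u]; rewrite mem_nseq => /andP[_ /eqP->].
have [] := trivial_word_cancels W powE; last first.
  move=> [s [A [U [B [e cU]]]]]; left.
  have [A' [R [powE' AE RE]]] := filter_eq_cat_cons e.
  have [U' [B' [RE' UE _]]] := filter_eq_cat_cons RE.
  have : s \in seq.filter W (flatten (nseq k w)).
    by rewrite e mem_cat inE eqxx orbT.
  rewrite mem_filter => /andP[/hasP [t tw cst] sw].
  apply: (@power_cyclically_cancels w k s t A' U' B') => //; first by rewrite powE' RE'.
  apply/allP => v vU; have [Wv|nWv] := boolP (W v).
    by apply: (allP cU); rewrite -UE mem_filter Wv.
  rewrite c_sym; apply: nW => //; exact: inpow.
move=> /eqP; rewrite -[_ == _]negbK -has_filter => /hasPn noW.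
have cw : {in w &, forall u v, c u v}.
  move=> u v uw vw; apply: nW => //; apply: noW.
  by rewrite -(prednK k0) mem_cat uw.
have [uw|nuw] := boolP (uniq w); [by right|left].
have [s [A [U [B wE]]]] := not_uniq_repeats nuw.
exists s, A, U, B; split=> //; left; apply/allP => v vU.
by apply: cw; rewrite wE !(mem_cat, inE) ?eqxx ?vU !orbT.
Qed.

Lemma cyclically_cancels_shorter (w : seq I) : cyclically_cancels w ->
  exists w' y, (size w' < size w)%N /\ word_prod g w ^ y = word_prod g w'.
Proof.
move=> [s [A [U [B [-> h]]]]].
exists (A ++ U ++ B), (if all (c s) U then 1 else g s).
split; first by rewrite !size_cat /= size_cat /=; lia.
rewrite !(word_prod_cat, word_prod_cons).
case: ifP h => [cU _|_ [//|[cA cB]]].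
  by rewrite conjg1 [g s * (_ * _)]mulgA (gen_commute_word P cU) -!mulgA (gen_mulK P).
rewrite conjgE.
rewrite (gen_inv P) -!mulgA -(gen_commute_word P cB) [g s * (word_prod g A * _)]mulgA.
by rewrite (gen_commute_word P cA) -mulgA !(gen_mulK P).
Qed.

Lemma torsion_conjugate_clique x k : (0 < k)%N -> x ^+ k = 1 ->
  exists y w, [/\ x ^ y = word_prod g w, uniq w & {in w &, forall u v, c u v}].
Proof.
move=> k0 xk.
have [w0 w0E] := word_prod_surjective P x.
pose len m := `[< exists w y, x ^ y = word_prod g w /\ size w = m >].
have ex_len : exists m, len m.
  by exists (size w0); apply/asboolP; exists w0, 1; rewrite conjg1 w0E.
(* A shortest word among those that represent a conjugate of [x]. *)
case: (ex_minnP ex_len) => m /asboolP [w [y [xy wm]]] min.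
have wk : word_prod g w ^+ k = 1 by rewrite -xy -conjXg xk conj1g.
case: (torsion_word_cancels_or_clique k0 wk) => [|[uw cw]]; last by exists y, w.
move=> /cyclically_cancels_shorter [w' [z [lt e]]].
have /min : len (size w').
  by apply/asboolP; exists w', (y * z); rewrite conjgM xy e.
by rewrite -wm leqNgt lt.
Qed.

(** A word with two distinct letters has no letter to cancel, even cyclically. *)
Lemma incompatible_infinite_order v w k :
  ~~ c v w -> (0 < k)%N -> (g v * g w) ^+ k <> 1.
Proof.
move=> ncvw k0; have -> : g v * g w = word_prod g [:: v; w].
  by rewrite word_prod_cons word_prod1.
move=> /(torsion_word_cancels_or_clique k0) [[s [A [U [B [e _]]]]]|[_ cw]].
  have := congr1 size e; rewrite size_cat /= size_cat /=.
  case: A e => [|? ?] /= e; last by lia.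
  case: U e => [|? ?] /= e; last by lia.
  by case: e ncvw => -> -> _; rewrite c_refl.
by move: ncvw; rewrite cw // !inE eqxx ?orbT.
Qed.

Lemma clique_square w : {in w &, forall u v, c u v} ->
  word_prod g w * word_prod g w = 1.
Proof.
elim: w => [|v w IH] cw; first by rewrite /word_prod big_nil mulg1.
have cvw : all (c v) w by apply/allP => u uw; rewrite cw ?inE ?eqxx ?uw ?orbT.
rewrite word_prod_cons -mulgA [_ * (g v * _)]mulgA -(gen_commute_word P cvw).
rewrite -mulgA (gen_mulK P) IH //.
by move=> a b aw bw; rewrite cw ?inE ?aw ?bw ?orbT.
Qed.

End Torsion.

(** * Subgroups, index and parities *)

Section Subgroups.
Context {G : groupType}.
Implicit Types (H S : set G).
Local Open Scope group_scope.

Lemma is_subgroupP H : is_subgroup H <->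
  H 1 /\ forall x y, H x -> H y -> H (x * y^-1).
Proof.
split=> [[/set_mem H1 Hdiv]|[H1 Hdiv]].
  split=> // x y Hx Hy; apply: set_mem; apply: Hdiv; exact: mem_set.
split; first exact/mem_set.
by move=> x y /set_mem Hx /set_mem Hy; apply/mem_set/Hdiv.
Qed.

Lemma subgroup1 H : is_subgroup H -> H 1.
Proof. by move=> /is_subgroupP[]. Qed.

Lemma subgroupV H x : is_subgroup H -> H x -> H x^-1.
Proof. by move=> /is_subgroupP[H1 Hd] Hx; rewrite -[x^-1]mul1g; apply: Hd. Qed.

Lemma subgroupM H x y : is_subgroup H -> H x -> H y -> H (x * y).
Proof.
move=> sH Hx Hy; move/is_subgroupP: (sH) => [_ Hd].
by rewrite -[y]invgK; apply: Hd => //; apply: subgroupV.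
Qed.

Lemma generated_subgroup S : is_subgroup (generated S).
Proof.
apply/is_subgroupP; split=> [H [sH _]|x y gx gy H sHS]; first exact: subgroup1.
have [sH _] := sHS; apply: subgroupM => //; first exact: gx.
by apply: subgroupV => //; apply: gy.
Qed.

Lemma generated_gen S x : S x -> generated S x.
Proof. by move=> Sx H [_ SH]; apply: SH. Qed.

Lemma generated_sub S H : is_subgroup H -> S `<=` H -> generated S `<=` H.
Proof. exact: smallest_sub. Qed.

Lemma mem_left_coset H x y : is_subgroup H ->
  [set x * z | z in H] y <-> H (x^-1 * y).
Proof.
move=> sH; split=> [[z Hz <-]|Hxy]; first by rewrite mulKg.
by exists (x^-1 * y); rewrite ?mulVKg.
Qed.

Lemma left_coset_eq H x y : is_subgroup H ->
  [set x * z | z in H] = [set y * z | z in H] -> H (x^-1 * y).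
Proof.
move=> sH e; apply/mem_left_coset => //; rewrite e.
by apply/mem_left_coset => //; rewrite mulVg; apply: subgroup1.
Qed.

Lemma card_finType (X : finType) : [set: X] #= `I_#|X|.
Proof.
have -> : [set: X] = [set enum_val i | i in [set: 'I_#|X|]].
  apply/seteqP; split=> x _ //; exists (enum_rank x) => //.
  exact: enum_rankK.
apply: card_eq_trans (inj_card_eq _) _; first by move=> i j _ _; apply: enum_val_inj.
by rewrite card_eq_sym card_II.
Qed.

(** Turns an index given by a bijection between cosets and numbers into a transversal. *)
Lemma index_representatives H k : is_subgroup H -> has_index H k ->
  exists r : 'I_k -> G, forall x, exists i, H ((r i)^-1 * x).
Proof.
move=> sH /card_set_bijP [f [f_fun f_inj f_surj]].
have rep (i : 'I_k) : exists x : G, f [set x * y | y in H] = i.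
  by have [_ [x _ <-] e] := f_surj i (ltn_ord i); exists x.
exists (fun i => projT1 (cid (rep i))) => x.
have fx : `I_k (f [set x * y | y in H]) by apply: f_fun; exists x.
exists (Ordinal fx); case: cid => z /= ze.
apply: left_coset_eq => //; apply: f_inj; rewrite ?inE //.
- by exists z.
- by exists x.
Qed.

Lemma leq_index (X : finType) (f : X -> G) H k :
  is_subgroup H -> has_index H k ->
  (forall a b, H ((f a)^-1 * f b) -> a = b) -> (#|X| <= k)%N.
Proof.
move=> sH Hk finj; have [r r_onto] := index_representatives sH Hk.
pose i a := projT1 (cid (r_onto (f a))).
have iP a : H ((r (i a))^-1 * f a) by rewrite /i; case: cid.
rewrite -[leqRHS]card_ord; apply: (leq_card i) => a b iab; apply: finj.
have -> : (f a)^-1 * f b = ((r (i a))^-1 * f a)^-1 * ((r (i a))^-1 * f b).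
  by rewrite invgM invgK -mulgA mulVKg.
apply: subgroupM => //; first by apply: subgroupV.
by rewrite iab.
Qed.

Lemma parity_of_1 (J : Type) (chi : G -> J -> bool) :
  (forall x y j, chi (x * y) j = chi x j (+) chi y j) ->
  forall j, chi 1 j = false.
Proof.
by move=> chiM j; have := chiM 1 1 j; rewrite mulg1; case: (chi 1 j).
Qed.

Lemma parity_of_inv (J : Type) (chi : G -> J -> bool) :
  (forall x y j, chi (x * y) j = chi x j (+) chi y j) ->
  forall x j, chi x^-1 j = chi x j.
Proof.
move=> chiM x j; have := chiM x x^-1 j; rewrite mulgV (parity_of_1 chiM).
by case: (chi x j); case: (chi _ j).
Qed.

Lemma parity_kernel_normal (J : Type) (chi : G -> J -> bool) :
  (forall x y j, chi (x * y) j = chi x j (+) chi y j) ->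
  is_normal_subgroup [set x | forall j, chi x j = false].
Proof.
move=> chiM; split.
  apply/is_subgroupP; split; first by move=> j; rewrite (parity_of_1 chiM).
  by move=> x y /= x0 y0 j; rewrite chiM (parity_of_inv chiM) x0 y0.
move=> x y /= x0 j; rewrite conjgE !chiM x0 (parity_of_inv chiM).
by case: (chi y j).
Qed.

Lemma parity_kernel_index (J : finType) (chi : G -> {ffun J -> bool}) :
  (forall x y j, chi (x * y) j = chi x j (+) chi y j) ->
  (forall a, exists x, chi x = a) ->
  has_index [set x | forall j, chi x j = false] (2 ^ #|J|)%N.
Proof.
move=> chiM chi_onto; rewrite /has_index.
have -> : (2 ^ #|J|)%N = #|{ffun J -> bool}| by rewrite card_ffun card_bool.
have -> : left_cosets [set x | forall j, chi x j = false] =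
    [set [set x | chi x = a] | a in [set: {ffun J -> bool}]].
  have cosetE x : [set x * y | y in [set y | forall j, chi y j = false]] =
      [set y | chi y = chi x].
    apply/seteqP; split=> [_ [y y0 <-]|y /= yx].
      by apply/ffunP => j; rewrite chiM y0 addbF.
    exists (x^-1 * y); last by rewrite mulVKg.
    by move=> j; rewrite chiM (parity_of_inv chiM) yx addbb.
  apply/seteqP; split=> [_ [x _ <-]|_ [a _ <-]].
    by exists (chi x); rewrite ?cosetE.
  by have [x <-] := chi_onto a; exists x; rewrite ?cosetE.
apply: card_eq_trans (inj_card_eq _) (card_finType _) => a b _ _ ab.
have [x xa] := chi_onto a.
have xb : [set y | chi y = b] x by rewrite -ab.
by rewrite -xa -xb.
Qed.

(** Pushed along [chi], a subgroup with [k] generators becomes a subspace with at most [2 ^ k]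
    elements, and the translates of that subspace by [m] coset representatives cover the
    whole space. *)
Lemma leq_rank_index (J : finType) (chi : G -> {ffun J -> bool}) H k m :
  (forall x y j, chi (x * y) j = chi x j (+) chi y j) ->
  (forall a, exists x, chi x = a) ->
  generated_by H k -> has_index H m -> (2 ^ #|J| <= 2 ^ k * m)%N.
Proof.
move=> chiM chi_onto [s Hs] Hm.
(* Elements of the span of the images of the generators. *)
pose comb (a : {ffun 'I_k -> bool}) j :=
  \big[addb/false]_(l < k) (a l && chi (tnth s l) j).
have sub_comb : H `<=` [set x | exists a, chi x =1 comb a].
  rewrite Hs; apply: generated_sub.
    apply/is_subgroupP; split.
      exists [ffun=> false] => j; rewrite (parity_of_1 chiM) /comb big1 // => l _.
      by rewrite ffunE.
    move=> x y [a xa] [b yb]; exists [ffun l => a l (+) b l] => j.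
    rewrite chiM (parity_of_inv chiM) xa yb -big_split /=.
    by apply: eq_bigr => l _; rewrite ffunE andb_addl.
  move=> x /= /tnthP[l ->]; exists [ffun i => i == l] => j.
  rewrite /comb (bigD1 l) //= big1 => [|i il]; rewrite ffunE; last by rewrite (negPf il).
  by rewrite eqxx addbF.
have sH : is_subgroup H by rewrite Hs; apply: generated_subgroup.
have [r r_onto] := index_representatives sH Hm.
pose f (p : {ffun 'I_k -> bool} * 'I_m) : {ffun J -> bool} :=
  [ffun j => chi (r p.2) j (+) comb p.1 j].
have -> : (2 ^ #|J|)%N = #|{ffun J -> bool}| by rewrite card_ffun card_bool.
have -> : (2 ^ k * m)%N = #|{: {ffun 'I_k -> bool} * 'I_m}|.
  by rewrite card_prod card_ffun card_bool !card_ord.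
have onto a : a \in codom f.
  have [x <-] := chi_onto a; have [i /sub_comb [b xb]] := r_onto x.
  apply/codomP; exists (b, i); apply/ffunP => j.
  by rewrite ffunE /= -xb chiM (parity_of_inv chiM) addbA addbb.
apply: leq_trans (leq_image_card f predT).
by apply: subset_leq_card; apply/fintype.subsetP => a _; apply: onto.
Qed.

End Subgroups.

Section ParityOfWords.
Context {G : groupType} {I : eqType}.
Variables (c : rel I) (g : I -> G).
Hypothesis P : right_angled_presentation c g.
Local Open Scope group_scope.

(** For each label [j], counting modulo 2 the letters labelled [j] does not depend on the
    word: the letters act on parity vectors by commuting involutions. *)
Lemma parity_hom (J : finType) (l : I -> J) :
  exists chi : G -> {ffun J -> bool},
    (forall x y j, chi (x * y) j = chi x j (+) chi y j) /\
    (forall v j, chi (g v) j = (l v == j)).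
Proof.
pose phi v (f : {ffun J -> bool}) := [ffun j => (l v == j) (+) f j].
pose par s := foldr phi [ffun=> false] s.
have par_cat s t j : par (s ++ t) j = par s j (+) par t j.
  elim: s => [|v s IH] /=; first by rewrite ffunE.
  by rewrite [LHS]ffunE [in RHS]ffunE IH addbA.
have par_eq s t : word_prod g s = word_prod g t -> par s = par t.
  apply: (@action_of_presentation _ _ _ _ P _ phi _ _ s t) => [v f|v w f _];
    apply/ffunP => j.
    by rewrite !ffunE addbA addbb.
  by rewrite !ffunE addbCA.
pose word_of x := projT1 (cid (word_prod_surjective P x)).
have word_ofK x : word_prod g (word_of x) = x by rewrite /word_of; case: cid.
exists (fun x => par (word_of x)); split=> [x y j|v j].
  by rewrite -par_cat; congr (_ _ j); apply: par_eq; rewrite word_prod_cat !word_ofK.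
have -> : par (word_of (g v)) = par [:: v].
  by apply: par_eq; rewrite word_ofK word_prod1.
by rewrite /= !ffunE addbF.
Qed.

Lemma parity_word_prod (J : eqType) (chi : G -> J -> bool) (l : I -> J) w j :
  (forall x y j, chi (x * y) j = chi x j (+) chi y j) ->
  (forall v j, chi (g v) j = (l v == j)) ->
  chi (word_prod g w) j = odd (count (fun v => l v == j) w).
Proof.
move=> chiM chig; elim: w => [|v w IH].
  by rewrite /word_prod big_nil (parity_of_1 chiM).
by rewrite word_prod_cons chiM chig IH /= oddD oddb.
Qed.

(** With a section [r] of the labelling, every parity vector [a] is attained, by the product
    of the chosen generators whose label is in the support of [a]. *)
Lemma parity_word_prod_section (J : finType) (chi : G -> {ffun J -> bool})
    (l : I -> J) (r : J -> I) (a : {ffun J -> bool}) :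
  (forall x y j, chi (x * y) j = chi x j (+) chi y j) ->
  (forall v j, chi (g v) j = (l v == j)) ->
  cancel r l ->
  chi (word_prod g (map r [seq j <- enum J | a j])) = a.
Proof.
move=> chiM chig rK; apply/ffunP => j.
rewrite (@parity_word_prod _ (fun x => chi x) l) // count_map.
rewrite (eq_count (a2 := pred1 j)) => [|i]; last by rewrite /= rK.
rewrite count_uniq_mem; last exact/filter_uniq/enum_uniq.
by rewrite mem_filter mem_enum andbT oddb.
Qed.

End ParityOfWords.

(** * Generators of a torsion-free normal subgroup *)

Section TypedGenerators.
Context {G : groupType} {I : eqType} {n : nat}.
Variables (c : rel I) (g : I -> G) (d : I -> 'I_n.+1).
Hypothesis P : right_angled_presentation c g.
Let gg := gen_involution P.
Let gV := gen_inv P.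
Let gK := gen_mulK P.
Local Open Scope group_scope.

(** With [d] the dimension, a flag is a maximal chain of simplices; its members generate an
    elementary abelian 2-group on which the parities of the types are coordinates. *)
Definition flag (e : 'I_n.+1 -> I) : Prop :=
  (forall i, d (e i) = i) /\ (forall i j, c (e i) (e j)).

(** Closure under galleries, the sequences of flags in which each differs from the next in a
    single member. *)
Definition gallery_closed (S : set I) : Prop :=
  forall e u, flag e -> (forall i, S (e i)) ->
    (forall j, j != d u -> c u (e j)) -> S u.

(** The invariant of the walk along galleries. When [S] contains every generator, [H] is
    normal and any flag surjects onto the quotient. *)
Definition type_normal (S : seq I) (H : set G) : Prop :=
  (forall s t, s \in S -> t \in S -> d s = d t -> H (g s * g t)) /\
  (forall s x, s \in S -> H x -> H (g s * x * g s)).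

Lemma conj_generated (T : set G) (H : set G) s : is_subgroup H ->
  (forall x, T x -> H (g s * x * g s)) ->
  forall x, generated T x -> H (g s * x * g s).
Proof.
move=> sH TH; apply: generated_sub => //; apply/is_subgroupP; split.
  by rewrite /= mulg1 gg; apply: subgroup1.
move=> x y /= Hx Hy.
have -> : g s * (x * y^-1) * g s = (g s * x * g s) * (g s * y * g s)^-1.
  by rewrite !invgM gV -!mulgA gK.
by apply: subgroupM => //; apply: subgroupV.
Qed.

(** Let [e] be a flag of [S] in which [u] can replace the member [e (d u)] of its type. The
    new element [y] is centralised by the other members of [e] and inverted by [e (d u)],
    so [e] normalises the enlarged subgroup; every other generator involved agrees with the
    member of [e] of its type up to an element of that subgroup. *)
Lemma type_normal_step (S : seq I) (X : seq G) (e : 'I_n.+1 -> I) u :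
  type_normal S (generated [set` X]) -> flag e -> (forall i, e i \in S) ->
  (forall j, j != d u -> c u (e j)) ->
  type_normal (u :: S) (generated [set` g (e (d u)) * g u :: X]).
Proof.
move=> [same norm] [de ce] eS cu.
set H := generated [set` X] in same norm *.
set y := g (e (d u)) * g u; set H' := generated _.
have sH' : is_subgroup H' by apply: generated_subgroup.
have HH' : H `<=` H'.
  apply: generated_sub => // x xX; apply: generated_gen.
  by rewrite /= inE; apply/orP; right.
have Hy : H' y by apply: generated_gen; rewrite /= inE eqxx.
have same' s t : s \in u :: S -> t \in u :: S -> d s = d t -> H' (g s * g t).
  have uu s1 : s1 \in S -> d s1 = d u -> H' (g s1 * g u).
    move=> s1S ds1; have -> : g s1 * g u = (g s1 * g (e (d u))) * y.
      by rewrite /y -mulgA gK.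
    by apply: (subgroupM sH') Hy; apply: HH'; apply: same => //; rewrite de.
  rewrite !inE => /orP[/eqP->|sS] /orP[/eqP->|tS] dst.
  - by rewrite gg; exact: (subgroup1 sH').
  - have -> : g u * g t = (g t * g u)^-1 by rewrite invgM !gV.
    by apply: (subgroupV sH'); apply: uu.
  - exact: uu.
  - by apply: HH'; apply: same.
have norm_e j x : H' x -> H' (g (e j) * x * g (e j)).
  apply: conj_generated => // {}x; rewrite /= inE => /orP[/eqP->|xX]; last first.
    by apply: HH'; apply: norm => //; apply: generated_gen.
  case: (eqVneq j (d u)) => [->|ju].
    have -> : g (e (d u)) * (g (e (d u)) * g u) * g (e (d u)) = y^-1.
      by rewrite gK /y invgM !gV.
    exact: (subgroupV sH').
  suff -> : g (e j) * (g (e (d u)) * g u) * g (e j) = y by [].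
  rewrite -!mulgA (gen_commute P (cu _ ju)) [g (e (d u)) * _]mulgA.
  by rewrite (gen_commute P (ce (d u) j)) -!mulgA gK.
split=> // s x sS Hx; pose z := g s * g (e (d s)).
have eS' j : e j \in u :: S by rewrite inE eS orbT.
have Hz : H' z by apply: same'; rewrite ?de.
have -> : g s * x * g s = z * (g (e (d s)) * x * g (e (d s))) * z^-1.
  by rewrite /z invgM !gV -!mulgA !gK.
by apply: (subgroupM sH') (subgroupV sH' Hz); apply: (subgroupM sH') Hz _; apply: norm_e.
Qed.

Variables (b : 'I_n.+1 -> I) (E : seq I).
Hypotheses (b_flag : flag b) (E_uniq : uniq E) (E_all : forall v, v \in E).
Hypothesis connected_through_galleries : forall S : set I,
  (forall i, S (b i)) -> gallery_closed S -> forall v, S v.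

(** Starting from the flag [b] with the trivial subgroup, each step meets one more generator
    and adds one element; galleries provide a step until every generator has been met. *)
Lemma type_normal_growth m : (n.+1 + m <= size E)%N ->
  exists (S : seq I) (X : seq G),
    [/\ uniq S /\ size S = (n.+1 + m)%N, size X = m, forall i, b i \in S,
      forall x, x \in X -> exists s t, d s = d t /\ x = g s * g t
      & type_normal S (generated [set` X])].
Proof.
have [db cb] := b_flag.
elim: m => [_|m IH lt_mE].
  exists (map b (enum 'I_n.+1)), [::].
  have bS i : b i \in map b (enum 'I_n.+1) by rewrite map_f // mem_enum.
  have gen1 x : generated [set` ([::] : seq G)] x -> x = 1.
    apply: (@generated_sub _ _ [set 1]) => //; apply/is_subgroupP.
    by split=> // ? ? -> ->; rewrite invg1 mulg1.
  split=> //.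
    split; last by rewrite size_map size_enum_ord addn0.
    by rewrite map_inj_uniq ?enum_uniq // => i j /(congr1 d); rewrite !db.
  split.
    move=> _ _ /mapP[i _ ->] /mapP[j _ ->]; rewrite !db => ->.
    by rewrite gg; apply: subgroup1; apply: generated_subgroup.
  move=> s x _ /gen1 ->; rewrite mulg1 gg.
  by apply: subgroup1; apply: generated_subgroup.
have [|S [X [[uS sizeS] sizeX bS XE SX]]] := IH; first by apply: leq_trans lt_mE; rewrite leq_add2l.
have [[e [u [e_flag eS cu uS']]]|noext] := pselect (exists e u,
    [/\ flag e, forall i, e i \in S, forall j, j != d u -> c u (e j) & u \notin S]).
  exists (u :: S), (g (e (d u)) * g u :: X); split.
  - by rewrite /= uS' sizeS addnS.
  - by rewrite /= sizeX.
  - by move=> i; rewrite inE bS orbT.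
  - move=> x; rewrite inE => /orP[/eqP->|/XE //].
    by exists (e (d u)), u; have [-> _] := e_flag.
  - exact: type_normal_step.
have all_S v : v \in S.
  apply: (connected_through_galleries (S := [set` S])) => // e u e_flag eS cu.
  have [//|uS'] := boolP (u \in S).
  by case: noext; exists e, u.
have := uniq_leq_size E_uniq (fun v _ => all_S v).
by rewrite sizeS leqNgt; case/negP; rewrite -addnS.
Qed.

(** In a clique a type occurs at most once, so a non-empty clique has an odd parity. *)
Lemma parity_kernel_torsion_free (delta : G -> 'I_n.+1 -> bool) :
  (forall v w, c v w -> d v = d w -> v = w) ->
  (forall x y j, delta (x * y) j = delta x j (+) delta y j) ->
  (forall v j, delta (g v) j = (d v == j)) ->
  torsion_free [set x | forall j, delta x j = false].
Proof.
move=> d_inj deltaM deltag x k /= x0 k0 xk.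
have [y [w [xy uw cw]]] := torsion_conjugate_clique P k0 xk.
have : forall j, delta (word_prod g w) j = false.
  move=> j; rewrite -xy conjgE !deltaM x0 (parity_of_inv deltaM).
  by case: (delta y j).
case: w uw cw xy => [|v w] uw cw xy w0.
  by apply/eqP; rewrite -(conjg_eq1 x y) xy /word_prod big_nil.
have := w0 (d v); rewrite (parity_word_prod _ _ deltaM deltag).
have -> : count (fun u => d u == d v) (v :: w) = count_mem v (v :: w).
  apply: eq_in_count => u uw'; apply/eqP/eqP => [|-> //].
  by apply: d_inj; apply: cw => //; rewrite inE eqxx.
by rewrite count_uniq_mem // inE eqxx.
Qed.

(** Modulo the subgroup grown along galleries every element is a product of members of the
    flag [b]; if all its parities vanish, that product lies in a torsion-free kernel and has
    square 1. *)
Lemma parity_kernel_generated (delta : G -> 'I_n.+1 -> bool) :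
  (forall v w, c v w -> d v = d w -> v = w) ->
  (forall x y j, delta (x * y) j = delta x j (+) delta y j) ->
  (forall v j, delta (g v) j = (d v == j)) ->
  generated_by [set x | forall j, delta x j = false] (size E - n.+1).
Proof.
move=> d_inj deltaM deltag.
have [db cb] := b_flag.
have sizeE : (n.+1 <= size E)%N.
  rewrite -[n.+1]card_ord cardE -(size_map b) uniq_leq_size //.
  by rewrite map_inj_uniq ?enum_uniq // => i j /(congr1 d); rewrite !db.
have [|S [X [[uS sizeS] sizeX bS XE [same norm]]]] := @type_normal_growth (size E - n.+1).
  by rewrite subnKC.
have all_S v : v \in S.
  have [|_ -> //] := uniq_min_size uS (fun v _ => E_all v).
  by rewrite sizeS subnKC.
exists (Tuple (introT eqP sizeX)); rewrite /=.
set H := generated _ in same norm *.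
have sH : is_subgroup H by apply: generated_subgroup.
have [sK _] := parity_kernel_normal deltaM.
have HK : H `<=` [set x | forall j, delta x j = false].
  apply: generated_sub => // x /XE [s [t [dst ->]]] j.
  by rewrite deltaM !deltag dst addbb.
apply/seteqP; split=> //= x x0.
have normal_form w : exists h s, H h /\ word_prod g w = h * word_prod g (map b s).
  elim: w => [|v w [h [s [Hh e]]]].
    by exists 1, [::]; split; [apply: subgroup1|rewrite /word_prod !big_nil mulg1].
  exists (g v * h * g v * (g v * g (b (d v)))), (d v :: s); split.
    by apply: (subgroupM sH); [apply: norm|apply: same; rewrite ?db].
  by rewrite /= !word_prod_cons e -!mulgA !gK.
have [w wx] := word_prod_surjective P x.
have [h [s [Hh e]]] := normal_form w.
have f1 : word_prod g (map b s) = 1.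
  apply: (@parity_kernel_torsion_free delta d_inj deltaM deltag _ 2) => // [j|].
    have := x0 j; rewrite -wx e deltaM; have := HK _ Hh j => /= ->.
    by rewrite addFb.
  rewrite expg2; apply: (clique_square P) => _ _ /mapP[i _ ->] /mapP[j _ ->].
  exact: cb.
by rewrite -wx e f1 mulg1.
Qed.

(** The flag [b] generates an elementary abelian group of order [2 ^ n.+1], whose non-trivial
    elements have order 2 and therefore lie outside [H]. *)
Lemma torsion_free_index (H : set G) k :
  is_subgroup H -> torsion_free H -> has_index H k -> (2 ^ n.+1 <= k)%N.
Proof.
move=> sH tfH Hk; have [db cb] := b_flag.
have [delta [deltaM deltag]] := parity_hom P d.
pose f (a : {ffun 'I_n.+1 -> bool}) := word_prod g (map b [seq j <- enum 'I_n.+1 | a j]).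
have fE a : delta (f a) = a by apply: (parity_word_prod_section _ deltaM deltag).
have -> : (2 ^ n.+1)%N = #|{ffun 'I_n.+1 -> bool}|.
  by rewrite card_ffun card_bool card_ord.
apply: (leq_index (f := f)) sH Hk _ => a a'.
have cl (s : seq 'I_n.+1) : {in map b s &, forall u v, c u v}.
  by move=> _ _ /mapP[i _ ->] /mapP[j _ ->]; apply: cb.
have ff : f a * f a = 1 by apply: (clique_square P); apply: cl.
have faV : (f a)^-1 = f a by apply: (@mulgI _ (f a)); rewrite mulgV ff.
rewrite faV => Hff; have /(congr1 delta) : f a = f a'; last by rewrite !fE.
apply: (@mulgI _ (f a)); rewrite ff; apply/esym.
apply: tfH Hff _ _; first exact: (isT : (0 < 2)%N).
by rewrite expg2 /f -word_prod_cat -map_cat (clique_square P) //; apply: cl.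
Qed.

(** Giving each generator its own label maps the group onto its largest elementary abelian
    2-quotient. *)
Lemma generator_count_bound (H : set G) k m :
  generated_by H k -> has_index H m -> (2 ^ size E <= 2 ^ k * m)%N.
Proof.
pose l v : 'I_(size E) := Ordinal (etrans (index_mem v E) (E_all v)).
have [chi [chiM chig]] := parity_hom P l.
rewrite -[X in (2 ^ X <= _)%N]card_ord; apply: (leq_rank_index chiM).
move=> a; exists (word_prod g (map (tnth (in_tuple E)) [seq j <- enum 'I_(size E) | a j])).
apply: (parity_word_prod_section _ chiM chig) => i; apply: val_inj => /=.
by rewrite (tnth_nth (tnth (in_tuple E) i)) /= index_uniq.
Qed.

(** The group-theoretic part of the argument, in which the complex only enters through the
    types of the generators and the galleries of flags. *)
Theorem typed_right_angled_group :
  (forall v w, c v w -> d v = d w -> v = w) ->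
  [/\ exists G1 : set G,
        [/\ is_normal_subgroup G1, torsion_free G1,
            has_index G1 (2 ^ n.+1)%N & generated_by G1 (size E - n.+1)],
      forall (H : set G) (k : nat),
        is_subgroup H -> torsion_free H -> has_index H k ->
        (2 ^ n.+1 <= k)%N
    & forall (H : set G) (k : nat),
        has_index H (2 ^ n.+1)%N ->
        generated_by H k -> (size E - n.+1 <= k)%N].
Proof.
move=> d_inj; have [db cb] := b_flag.
have [delta [deltaM deltag]] := parity_hom P d.
split.
- exists [set x | forall j, delta x j = false]; split.
  + exact: (parity_kernel_normal deltaM).
  + exact: (parity_kernel_torsion_free d_inj deltaM deltag).
  + rewrite -[X in (2 ^ X)%N]card_ord; apply: (parity_kernel_index deltaM) => a.
    exists (word_prod g (map b [seq j <- enum 'I_n.+1 | a j])).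
    exact: (parity_word_prod_section _ deltaM deltag).
  + exact: (parity_kernel_generated d_inj deltaM deltag).
- by move=> H k; apply: torsion_free_index.
- move=> H k indexH genH; have := generator_count_bound genH indexH.
  by rewrite -expnD leq_exp2l // leq_subLR addnC.
Qed.

End TypedGenerators.

(** * Strong connectivity *)

Section Topology.
Context {R : realType} {T : choiceType}.
Local Open Scope fset_scope.
Local Open Scope ring_scope.

Lemma continuous_face_mass (t : {fset T}) :
  continuous (fun p : {ptws T -> R} => \sum_(x <- t) p x).
Proof.
apply: continuous_big => [|x _]; first exact: add_continuous.
exact: (@proj_continuous T (fun=> R) x).
Qed.

Lemma closed_face (t : {fset T}) :
  closed [set p : {ptws T -> R} | \sum_(x <- t) p x = 1].
Proof.
apply: (preimage_closed (D := [set r : R | r = 1])).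
  by move=> p _; apply: continuous_face_mass.
exact: closed_eq.
Qed.

(** The coordinates of [p] are non-negative with sum 1, so none is left for points off [t]. *)
Lemma full_mass_support (s t : {fset T}) (p : T -> R) :
  (forall x, 0 <= p x) -> (forall x, x \notin s -> p x = 0) ->
  \sum_(x <- s) p x = 1 -> \sum_(x <- t) p x = 1 ->
  forall x, x \notin t -> p x = 0.
Proof.
move=> p0 ps s1 t1 x xt; apply/eqP; rewrite eq_le p0 andbT.
have [xs|/ps -> //] := boolP (x \in s).
have tot : \sum_(y <- s `|` t) p y = 1.
  by rewrite -(big_fset_incl _ (fsubsetUl s t)) // => y _ /ps.
have : \sum_(y <- x |` t) p y <= \sum_(y <- s `|` t) p y.
  rewrite [leRHS](big_fsetID _ (mem (x |` t))) /=.
  rewrite (_ : [fset y in s `|` t | y \in x |` t] = x |` t); last first.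
    apply/fsetP => y; rewrite !inE /= andbC.
    case: (eqVneq y x) => [->|_] /=; first by rewrite xs.
    by case: (y \in t) => //=; rewrite orbT.
  by rewrite lerDl; apply: sumr_ge0 => y _.
by rewrite big_fsetU1 //= t1 tot; lra.
Qed.

(** Membership in a closed simplex [t] is the closed condition that the coordinates on [t]
    sum to 1. The n-simplices in [A] and those outside [A] cover the space by two closed
    sets. A common point of [t] in [A] and [u] outside [A] has its support in the simplex
    [t `&` u]; this simplex has dimension at most [n - 2], because otherwise [u] would be
    equal or adjacent to [t], so the point lies in the removed skeleton. *)
Lemma strongly_connected (L A : set {fset T}) (n : nat) (t0 : {fset T}) :
  is_simplicial_complex L -> finite_set L ->
  (forall s, L s -> exists t, [/\ L t, simplex_dim t = n%:Z & s `<=` t]) ->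
  connected (realisation R L `\` realisation R (skeleton L (n%:Z - 2)))%classic ->
  A t0 -> L t0 -> #|` t0| = n.+1 ->
  (forall t u, A t -> L t -> L u -> #|` t| = n.+1 -> #|` u| = n.+1 ->
     #|` t `&` u| = n -> A u) ->
  forall t, L t -> #|` t| = n.+1 -> A t.
Proof.
move=> [L_ne L_face] L_fin pure conn At0 Lt0 t0n A_closed.
set X := (_ `\` _)%classic in conn.
pose face_set (B : set {fset T}) : set {ptws T -> R} :=
  (\bigcup_(t in [set t | [/\ L t, #|` t| = n.+1 & B t]])
    [set p : {ptws T -> R} | (\sum_(x <- t) p x = 1)%R])%classic.
have face_set_closed B : closed (face_set B).
  apply: closed_bigcup => [|t _]; last exact: closed_face.
  by apply: sub_finite_set L_fin => t [].
pose bary (t : {fset T}) : {ptws T -> R} :=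
  fun x => if x \in t then (n.+1%:R)^-1 else 0.
have bary_sum t (u : {fset T}) : u `<=` t -> #|` t| = n.+1 ->
    \sum_(x <- u) bary t x = #|` u|%:R / n.+1%:R.
  move=> ut tn; rewrite big_seq (eq_bigr (fun=> (n.+1%:R)^-1)); last first.
    by move=> x xu; rewrite /bary (fsubsetP ut).
  by rewrite -big_seq big_const_seq count_predT iter_addr addr0 mulr_natl.
have bary_X t : L t -> #|` t| = n.+1 -> X (bary t).
  move=> Lt tn; split.
    split; first by move=> x; rewrite /bary; case: ifP => // _; rewrite invr_ge0.
    exists t => //; split; first by move=> x /negPf; rewrite /bary => ->.
    by rewrite bary_sum // tn divff.
  move=> [_ [s [Ls dim_s] [sup _]]].
  have : t `<=` s.
    apply/fsubsetP => x xt; apply/negPn/negP => /sup; rewrite /bary xt.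
    by apply/eqP; rewrite invr_eq0 pnatr_eq0.
  by move=> /fsubset_leq_card; rewrite tn; move: dim_s; rewrite /simplex_dim; lia.
have bary_full t : #|` t| = n.+1 -> (\sum_(x <- t) bary t x = 1)%R.
  by move=> tn; rewrite bary_sum // tn divff.
have cover p : X p -> face_set A p \/ face_set (~` A)%classic p.
  move=> [[p0 [s Ls [ps s1]]] _]; have [t [Lt dim_t st]] := pure s Ls.
  have tn : #|` t| = n.+1 by move: dim_t; rewrite /simplex_dim; lia.
  have t1 : (\sum_(x <- t) p x = 1)%R.
    by rewrite -(big_fset_incl _ st) // => x _ /ps.
  by have [At|nAt] := pselect (A t); [left|right]; exists t.
have disjoint p : X p -> face_set A p -> ~ face_set (~` A)%classic p.
  move=> [[p0 [s Ls [ps s1]]] p_skel] [t [Lt tn At] /= t1] [u [Lu un nAu] /= u1].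
  have pt := full_mass_support p0 ps s1 t1; have pu := full_mass_support p0 ps s1 u1.
  have tu1 : (\sum_(x <- t `&` u) p x = 1)%R.
    rewrite (big_fset_incl _ (fsubsetIl t u)) // => x xt.
    by rewrite inE xt => /pu.
  have tu_ne : t `&` u != fset0.
    by apply/eqP => e; move: tu1; rewrite e big_seq_fset0 => /eqP; rewrite eq_sym oner_eq0.
  have Ltu : L (t `&` u) by apply: L_face Lt tu_ne (fsubsetIl _ _).
  have le_n : (#|` t `&` u| <= n)%N.
    rewrite leqNgt; apply/negP => lt; apply: nAu.
    have tE : t `&` u = t by apply/eqP; rewrite eqEfcard fsubsetIl tn.
    have uE : t `&` u = u by apply/eqP; rewrite eqEfcard fsubsetIr un.
    by rewrite -uE tE.
  have ge_n : (n <= #|` t `&` u|)%N.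
    rewrite leqNgt; apply/negP => lt; apply: p_skel; split=> //.
    exists (t `&` u); first by split=> //; rewrite /simplex_dim; lia.
    split=> // x; rewrite inE negb_and => /orP[/pt|/pu] //.
  by apply: nAu; apply: (A_closed t) => //; apply/eqP; rewrite eqn_leq le_n.
(* The part covered by [A] is relatively open because its complement is the other part. *)
have XA : (X `&` face_set A = X)%classic.
  apply: conn.
  - by exists (bary t0); split; [apply: bary_X|exists t0 => //; apply: bary_full].
  - exists (~` face_set (~` A))%classic; first by apply: closed_openC.
    apply/seteqP; split=> p [Xp pA]; split=> //; first exact: disjoint.
    by case: (cover p Xp).
  - by exists (face_set A).
move=> t Lt tn; have [//|nAt] := pselect (A t).
have Xt := bary_X t Lt tn.
have : (X `&` face_set A)%classic (bary t) by rewrite XA.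
by move=> [_ /(disjoint _ Xt)] []; exists t => //; apply: bary_full.
Qed.

End Topology.

(** * Galleries of flags *)

(** Adjacent transpositions generate all permutations. *)
Lemma adjacent_swaps (T : eqType) (Q : seq T -> Prop) :
  (forall A x y B, Q (A ++ x :: y :: B) -> Q (A ++ y :: x :: B)) ->
  forall s s', perm_eq s s' -> Q s -> Q s'.
Proof.
move=> swap s s'.
have front A B x C : Q (A ++ B ++ x :: C) -> Q (A ++ x :: B ++ C).
  elim/last_ind: B C => [|B y IH] C //.
  rewrite -cats1 -!catA /= => q.
  by apply: IH; rewrite catA; apply: swap; rewrite -catA.
suff gen A : perm_eq s s' -> Q (A ++ s) -> Q (A ++ s') by apply: (gen [::]).
elim: s' s A => [|x s' IH] s A; first by move=> /perm_nilP ->.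
move=> ss'; have xs : x \in s by rewrite (perm_mem ss') mem_head.
case/splitPr: xs ss' => B C ss' /front q.
rewrite -cat1s catA; apply: (IH (B ++ C)); last by rewrite -catA.
by rewrite -(perm_cons x) (perm_trans _ ss') // -cat1s -[x :: C]cat1s perm_catCA.
Qed.

Section Orderings.
Context {T : choiceType}.
Local Open Scope fset_scope.
Local Open Scope nat_scope.
Variables (L Phi : set {fset T}) (n : nat).

(** An ordering of the vertices of a simplex amounts to a maximal flag of its faces, the
    i-dimensional member being spanned by the first [i.+1] vertices. *)
Definition prefix_face (w : seq T) (i : nat) : {fset T} := [fset x in take i.+1 w].

Definition chain_flag (e : 'I_n.+1 -> {fset T}) : Prop :=
  (forall i, L (e i) /\ #|` e i| = i.+1) /\
  (forall i j, e i `<=` e j \/ e j `<=` e i).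

Hypothesis L_complex : is_simplicial_complex L.
Hypothesis Phi_closed : forall e u, chain_flag e -> (forall i, Phi (e i)) -> L u ->
  (forall j : 'I_n.+1, j.+1 != #|` u| -> u `<=` e j \/ e j `<=` u) -> Phi u.

Definition ordering (w : seq T) : Prop :=
  [/\ uniq w, size w = n.+1 & L [fset x in w]].

Lemma in_fset_seq (s : seq T) x : (x \in [fset y in s]) = (x \in s).
Proof. by rewrite inE. Qed.

Lemma card_prefix_face w i : ordering w -> (i <= n)%N -> #|` prefix_face w i| = i.+1.
Proof.
move=> [uw sw _] le_in; rewrite /prefix_face card_fseq undup_id ?take_uniq //.
by rewrite size_take sw; case: ltnP; lia.
Qed.

Lemma prefix_face_mono w i j : (i <= j)%N -> prefix_face w i `<=` prefix_face w j.
Proof.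
move=> le_ij; apply/fsubsetP => x; rewrite !in_fset_seq.
by rewrite -(@take_takel _ i.+1 j.+1) // => /mem_take.
Qed.

Lemma prefix_face_sub w i : prefix_face w i `<=` [fset x in w].
Proof. by apply/fsubsetP => x; rewrite !in_fset_seq; apply: mem_take. Qed.

Lemma prefix_flag w : ordering w -> chain_flag (fun i : 'I_n.+1 => prefix_face w i).
Proof.
move=> ow; have [uw sw Lw] := ow; have [_ down] := L_complex.
split=> [i|i j]; last by case: (leqP i j) => [|/ltnW] /prefix_face_mono; [left|right].
have ci := card_prefix_face ow (ltn_ord i : i <= n); split=> //.
apply: (down _ _ Lw); last exact: prefix_face_sub.
by rewrite -cardfs_gt0 ci.
Qed.

Definition filled (w : seq T) : Prop := forall i, (i <= n)%N -> Phi (prefix_face w i).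

(** Swapping the vertices in positions [i] and [i.+1] changes only the i-dimensional member of
    the flag. *)
Lemma filled_swap A x y B :
  ordering (A ++ x :: y :: B) /\ filled (A ++ x :: y :: B) ->
  ordering (A ++ y :: x :: B) /\ filled (A ++ y :: x :: B).
Proof.
set w := A ++ x :: y :: B; set w' := A ++ y :: x :: B.
move=> [ow fw]; have [uw sw Lw] := ow.
have ww' : perm_eq w w'.
  by rewrite perm_cat2l -(cat1s x) -(cat1s y) perm_catCA.
have face_eq : [fset z in w'] = [fset z in w].
  by apply/fsetP => z; rewrite !in_fset_seq (perm_mem ww').
have ow' : ordering w'.
  by split; rewrite -?(perm_uniq ww') -?(perm_size ww') ?face_eq.
have same j : j != size A -> prefix_face w' j = prefix_face w j.
  rewrite neq_ltn => /orP[lt_jA|lt_Aj]; first by rewrite /prefix_face !takel_cat.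
  apply/fsetP => z; rewrite !in_fset_seq /w /w' !take_cat.
  have -> : (j.+1 < size A)%N = false by lia.
  have -> : (j.+1 - size A = (j - (size A).+1).+2)%N by lia.
  by rewrite /= !(mem_cat, inE); congr (_ || _); rewrite orbCA.
split=> // i le_in; have [iA|/same ->] := eqVneq i (size A); last exact: fw.
have [Lu cu] := (prefix_flag ow').1 (Ordinal (le_in : i < n.+1)).
apply: (Phi_closed (prefix_flag ow)) => // [j|j].
  by apply: fw; rewrite -ltnS.
rewrite cu eqSS => /= ji; rewrite -same -?iA //.
by case: (leqP i j) => [|/ltnW] /prefix_face_mono; [left|right].
Qed.

Lemma filled_perm w w' : perm_eq w w' ->
  ordering w /\ filled w -> ordering w' /\ filled w'.
Proof.
by apply: (@adjacent_swaps _ (fun w => ordering w /\ filled w)) => *; apply: filled_swap.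
Qed.

(** By [filled_perm] one ordering of the vertices stands for all of them. *)
Definition filled_simplex (t : {fset T}) : Prop :=
  L t /\ exists w, [/\ [fset x in w] = t, ordering w & filled w].

Lemma filled_simplex_ordering t w : filled_simplex t -> perm_eq w t -> filled w.
Proof.
move=> [Lt [w0 [w0t ow0 fw0]]] wt.
have [] // := @filled_perm w0 w _ (conj ow0 fw0).
have [uw0 _ _] := ow0.
apply: uniq_perm => //; first by rewrite (perm_uniq wt) fset_uniq.
by move=> x; rewrite (perm_mem wt) -w0t in_fset_seq.
Qed.

Lemma perm_enum_fsetID (t s : {fset T}) : s `<=` t ->
  perm_eq ((s : seq T) ++ (t `\` s : {fset T})) t.
Proof.
move=> st; apply: uniq_perm; rewrite ?fset_uniq //.
  rewrite cat_uniq !fset_uniq andbT /=; apply/hasPn => x.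
  by rewrite inE => /andP[].
move=> x; rewrite mem_cat -[X in _ || X]/(x \in t `\` s) in_fsetD.
by case: (boolP (x \in s)) => //= xs; rewrite (fsubsetP st).
Qed.

Lemma ordering_enum t w : L t -> #|` t| = n.+1 -> perm_eq w t -> ordering w.
Proof.
move=> Lt tn wt; split; first by rewrite (perm_uniq wt) fset_uniq.
  by rewrite (perm_size wt).
suff -> : [fset x in w] = t by [].
by apply/fsetP => x; rewrite in_fset_seq (perm_mem wt).
Qed.

Lemma prefix_face_cat (s : {fset T}) (r : seq T) :
  s != fset0 -> prefix_face ((s : seq T) ++ r) #|` s|.-1 = s.
Proof.
rewrite -cardfs_gt0 => s0; apply/fsetP => x.
by rewrite in_fset_seq prednK // take_size_cat.
Qed.

(** A face is a member of the flag of any ordering that lists its vertices first. *)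
Lemma filled_faces t s : filled_simplex t -> #|` t| = n.+1 -> s `<=` t -> s != fset0 ->
  Phi s.
Proof.
move=> ft tn st s0.
rewrite -(prefix_face_cat (t `\` s : {fset T}) s0).
apply: (filled_simplex_ordering ft (perm_enum_fsetID st)).
by have := fsubset_leq_card st; rewrite tn; lia.
Qed.

(** List the vertices of the common face first: the flags of [t] and [u] then differ only in
    their top members. *)
Lemma filled_neighbour t u : filled_simplex t -> L u ->
  #|` t| = n.+1 -> #|` u| = n.+1 -> #|` t `&` u| = n -> filled_simplex u.
Proof.
move=> ft Lu tn un tun; have [Lt _] := ft; set s := t `&` u in tun.
have st : s `<=` t := fsubsetIl t u; have su : s `<=` u := fsubsetIr t u.
pose w := (s : seq T) ++ (t `\` s : {fset T}).
pose w' := (s : seq T) ++ (u `\` s : {fset T}).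
have wt : perm_eq w t := perm_enum_fsetID st.
have w'u : perm_eq w' u := perm_enum_fsetID su.
have ow := ordering_enum Lt tn wt; have ow' := ordering_enum Lu un w'u.
have fw := filled_simplex_ordering ft wt.
have same j : (j < n)%N -> prefix_face w' j = prefix_face w j.
  by move=> jn; rewrite /prefix_face !takel_cat // tun.
have w'u_eq : [fset x in w'] = u.
  by apply/fsetP => x; rewrite in_fset_seq (perm_mem w'u).
split=> //; exists w'; split=> // i le_in.
have [jn|nj] := ltnP i n; first by rewrite same //; apply: fw.
have -> : i = n by apply/eqP; rewrite eqn_leq le_in.
have -> : prefix_face w' n = u.
  by rewrite /prefix_face take_oversize // (perm_size w'u) un.
apply: (Phi_closed (prefix_flag ow)) => // [j|j]; first by apply: fw; rewrite -ltnS.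
rewrite un eqSS => jn; right; rewrite -same; last by rewrite ltn_neqAle jn -ltnS ltn_ord.
by rewrite -[X in _ `<=` X]w'u_eq prefix_face_sub.
Qed.

End Orderings.

(** Inside one n-simplex galleries permute the vertices, and across a common (n-1)-face they
    pass to an adjacent n-simplex; strong connectivity does the rest. *)
Lemma gallery_connected (R : realType) (T : choiceType) (L Phi : set {fset T}) (n : nat) w0 :
  is_simplicial_complex L -> finite_set L ->
  (forall s, L s -> exists t, [/\ L t, simplex_dim t = n%:Z & (s `<=` t)%fset]) ->
  connected (realisation R L `\` realisation R (skeleton L (n%:Z - 2))) ->
  ordering L n w0 -> filled Phi n w0 ->
  (forall e u, chain_flag L e -> (forall i : 'I_n.+1, Phi (e i)) -> L u ->
    (forall j : 'I_n.+1, j.+1 != #|` u| -> (u `<=` e j)%fset \/ (e j `<=` u)%fset) -> Phi u) ->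
  forall s, L s -> Phi s.
Proof.
move=> Lc Lf pure conn ow0 fw0 cl s Ls.
have [t [Lt dim_t st]] := pure s Ls.
have tn : #|` t| = n.+1 by move: dim_t; rewrite /simplex_dim; lia.
have [s0 _] := Lc.
apply: (@filled_faces _ _ _ n Lc cl t) => //; last exact: s0.
have [uw sw Lw] := ow0.
apply: (strongly_connected (A := filled_simplex L Phi n) Lc Lf pure conn _ Lw) => //.
- by split=> //; exists w0.
- by rewrite card_fseq undup_id.
- by move=> t1 u ft _ Lu t1n un; apply: filled_neighbour ft Lu t1n un.
Qed.

(** * The simplices of K *)

Section FiniteSpecial.
Context {G : groupType}.
Local Open Scope group_scope.

(** The subgroup is contained in [{1, x, y, x y}]. *)
Lemma finite_commuting_involutions (x y : G) :
  x * x = 1 -> y * y = 1 -> x * y = y * x ->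
  finite_set (generated [set` [fset x; y]%fset]).
Proof.
move=> xx yy xy.
have xxK z : x * (x * z) = z by rewrite mulgA xx mul1g.
have yyK z : y * (y * z) = z by rewrite mulgA yy mul1g.
have xV : x^-1 = x by apply: (@mulgI _ x); rewrite mulgV xx.
have yV : y^-1 = y by apply: (@mulgI _ y); rewrite mulgV yy.
have yxK z : y * (x * z) = x * (y * z) by rewrite !mulgA xy.
pose K : {fset G} := [fset 1; x; y; x * y]%fset.
apply: (@sub_finite_set _ _ [set` K]); last exact: finite_fset.
apply: generated_sub; last first.
  by move=> z /=; rewrite !inE => /orP[] ->; rewrite ?orbT.
apply/is_subgroupP; split=> [|u v] /=; first by rewrite !inE eqxx.
rewrite !inE => /orP[/orP[/orP[]|]|] /eqP-> /orP[/orP[/orP[]|]|] /eqP->;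
  rewrite ?invgM ?invg1 ?xV ?yV ?mulg1 ?mul1g ?xx ?yy -?mulgA
    ?xx ?yy ?xxK ?yyK ?yxK ?xxK ?yyK ?mulg1 ?eqxx ?orbT //.
all: by rewrite -?xy ?xxK ?yyK ?xx ?eqxx ?orbT.
Qed.

Lemma infinite_order_subgroup (x : G) (H : set G) :
  is_subgroup H -> H x -> (forall k, (0 < k)%N -> x ^+ k <> 1) -> ~ finite_set H.
Proof.
move=> sH Hx x_inf fH; apply: infinite_nat.
have inj : {in [set: nat] &, injective (fun k => x ^+ k)}.
  have lt_neq i j : (i < j)%N -> x ^+ i <> x ^+ j.
    move=> ij e; apply: (x_inf (j - i)%N); first by rewrite subn_gt0.
    by rewrite (expgnFr x (ltnW ij)) -e mulgV.
  move=> i j _ _ e; have [/lt_neq|/lt_neq|//] := ltngtP i j => //.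
  by rewrite e.
have sub : [set x ^+ k | k in [set: nat]] `<=` H.
  move=> _ [k _ <-]; elim: k => [|k IH]; first exact: subgroup1.
  by rewrite expgS; apply: subgroupM.
have := sub_finite_set sub fH.
by apply: card_le_finite; have := inj_card_eq inj; rewrite card_eq_le => /andP[].
Qed.

Lemma special_pair_finite (I : eqType) (c : rel I) (g : I -> G) v w :
  right_angled_presentation c g ->
  finite_set (generated [set` [fset g v; g w]%fset]) <-> c v w.
Proof.
move=> P; split=> [fin|cvw]; last first.
  apply: finite_commuting_involutions; try exact: (gen_involution P).
  exact: (gen_commute P).
have [//|ncvw] := boolP (c v w); exfalso.
have sub := generated_subgroup [set` [fset g v; g w]%fset].
apply: (infinite_order_subgroup (x := g v * g w) sub _ _ fin) => [|k].
  by apply: (subgroupM sub); apply: generated_gen; rewrite /= !inE eqxx ?orbT.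
exact: (incompatible_infinite_order P).
Qed.

End FiniteSpecial.

Lemma coxeter_complex_vertices (G : groupType) (V : set G) (c : rel V) :
  right_angled_presentation c (fun v : V => \val v) ->
  vertices (coxeter_complex V) = V.
Proof.
move=> P; apply/seteqP; split=> [x [_ sub _]|x Vx].
  by apply: sub; rewrite /= !inE.
pose v : V := exist _ x (mem_set Vx).
split; first by apply/fset0Pn; exists x; rewrite inE.
  by move=> y /=; rewrite inE => /eqP ->.
have := (special_pair_finite v v P).2 (compat_refl P v).
by rewrite fsetUid.
Qed.

Lemma barycentric_vertices (T : choiceType) (L : set {fset T}) :
  vertices (barycentric_subdivision L) = L.
Proof.
apply/seteqP; split=> [s [_ sub _]|s Ls].
  by apply: sub; rewrite /= inE.
split; first by apply/fset0Pn; exists s; rewrite inE.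
  by move=> t /=; rewrite inE => /eqP ->.
by move=> t u; rewrite !inE => /eqP -> /eqP ->; left.
Qed.

(** The given isomorphism matches vertices with vertices, that is generators with simplices,
    and edges with edges. An edge of the barycentric subdivision is a pair of comparable
    simplices; an edge of the Coxeter complex is a pair of generators spanning a finite
    subgroup, that is a commuting pair. *)
Lemma simplex_labelling (T : choiceType) (L : set {fset T})
    (G : groupType) (V : set G) (c : rel V) :
  right_angled_presentation c (fun v : V => \val v) ->
  isomorphic_complexes (coxeter_complex V) (barycentric_subdivision L) ->
  exists F : V -> {fset T},
    [/\ injective F, forall v, L (F v), forall s, L s -> exists v, F v = s
      & forall v w, c v w <-> ((F v `<=` F w)%fset \/ (F w `<=` F v)%fset)].
Proof.
move=> P [f [[]]]; rewrite (coxeter_complex_vertices P) barycentric_vertices.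
move=> f_fun f_inj f_surj f_simplex.
have Vv (v : V) : V (\val v) by apply: set_mem; apply: valP.
exists (fun v => f (\val v)); split.
- move=> v w e; apply: val_inj; apply: f_inj; rewrite ?inE //; exact: valP.
- by move=> v; apply: f_fun.
- by move=> s /f_surj [x Vx <-]; exists (exist _ x (mem_set Vx)).
move=> v w; set A := [fset \val v; \val w]%fset.
have AV : [set` A] `<=` V by move=> x /=; rewrite !inE => /orP[] /eqP ->.
rewrite -(special_pair_finite v w P).
have -> : finite_set (generated [set` A]) <-> coxeter_complex V A.
  split=> [fin|[] //]; split=> //.
  by apply/fset0Pn; exists (\val v); rewrite !inE eqxx.
rewrite (f_simplex A AV).
have fA x : x \in [fset f x | x in A]%fset <-> x = f (\val v) \/ x = f (\val w).
  split=> [/imfsetP [y /=]|].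
    by rewrite !inE => /orP[] /eqP -> ->; [left|right].
  by case=> ->; apply: in_imfset; rewrite !inE eqxx ?orbT.
split=> [[_ _ chain]|cmp].
  by apply: chain; apply/fA; [left|right].
split.
- by apply/fset0Pn; exists (f (\val v)); apply/fA; left.
- by move=> x /fA [] ->; apply: f_fun.
- move=> s t /fA [] -> /fA [] ->; [by left| | |by left] => //.
  by case: cmp; [right|left].
Qed.

Theorem corollary12 (R : realType) (T : choiceType) (L : set {fset T})
    (n N : nat)
    (L_complex : is_simplicial_complex L)
    (L_dim : has_dimension L n%:Z)
    (L_card : L #= `I_N)
    (L_pure : forall s, L s ->
       exists t, [/\ L t, simplex_dim t = n%:Z & (s `<=` t)%fset])
    (L_conn : connected
       (realisation R L `\` realisation R (skeleton L (n%:Z - 2))))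
    (G : groupType) (V : set G)
    (GV : right_angled_coxeter_system V)
    (K_bary : isomorphic_complexes (coxeter_complex V)
                                   (barycentric_subdivision L)) :
  [/\ exists G1 : set G,
        [/\ is_normal_subgroup G1, torsion_free G1,
            has_index G1 (2 ^ n.+1)%N & generated_by G1 (N - n - 1)%N],
      forall (H : set G) (k : nat),
        is_subgroup H -> torsion_free H -> has_index H k ->
        (2 ^ n.+1 <= k)%N
    & forall (H : set G) (k : nat),
        is_normal_subgroup H -> has_index H (2 ^ n.+1)%N ->
        generated_by H k -> (N - n - 1 <= k)%N].
Proof.
have [c P] := right_angled_presentationP GV.
have [F [F_inj LF F_onto c_cmp]] := simplex_labelling P K_bary.
have L_fin : finite_set L by apply/finite_setP; exists N.
have [[t0 Lt0 dim_t0] dim_le] := L_dim.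
have t0n : #|` t0| = n.+1 by move: dim_t0; rewrite /simplex_dim; lia.
have card_L s : L s -> (0 < #|` s| <= n.+1)%N.
  move=> Ls; have := dim_le s Ls; rewrite cardfs_gt0 L_complex.1 //.
  by rewrite /simplex_dim; lia.
have [v0 _] := F_onto t0 Lt0.
(* The inverse of [F]; the default value [v0] is only taken outside [L]. *)
pose vertex_of s :=
  if pselect (exists v, F v = s) is left ex then projT1 (cid ex) else v0.
have vertex_ofK s : L s -> F (vertex_of s) = s.
  move=> Ls; rewrite /vertex_of; case: pselect => [ex|]; first by case: cid.
  by case; apply: F_onto.
have F_vertex v : vertex_of (F v) = v by apply: F_inj; rewrite vertex_ofK.
pose d v : 'I_n.+1 := inord #|` F v|.-1.
have dE v : (d v).+1 = #|` F v|.
  have /andP[c0 cn] := card_L _ (LF v).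
  by rewrite inordK ?prednK.
pose E := map vertex_of (fset_set L).
have sizeE : size E = N by rewrite size_map (card_fset_set L_card).
have E_uniq : uniq E.
  rewrite map_inj_in_uniq ?fset_uniq // => s t.
  by rewrite !in_fset_set // !inE => Ls Lt /(congr1 F); rewrite !vertex_ofK.
have E_all v : v \in E.
  rewrite -(F_vertex v) map_f // in_fset_set // inE; exact: LF.
have d_inj v w : c v w -> d v = d w -> v = w.
  move=> /c_cmp cmp dvw; apply: F_inj.
  have cards : #|` F v| = #|` F w| by rewrite -!dE dvw.
  by case: cmp => sub; [|apply/esym]; apply/eqP; rewrite eqEfcard sub cards leqnn.
have ow0 : ordering L n t0 by apply: (ordering_enum Lt0 t0n).
have flag0 := prefix_flag L_complex ow0.
have flag_lift e : chain_flag L e -> flag c d (fun i : 'I_n.+1 => vertex_of (e i)).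
  move=> [Le ce]; split=> [i|i j].
    apply: val_inj; apply: succn_inj; have [Lei ei] := Le i.
    by rewrite dE vertex_ofK.
  by apply/c_cmp; rewrite !vertex_ofK //; case: (Le i); case: (Le j).
pose b (i : 'I_n.+1) := vertex_of (prefix_face t0 i).
have gal (S : set V) : (forall i, S (b i)) -> gallery_closed c d S -> forall v, S v.
  move=> Sb Scl v.
  have [] : [set s | exists v, F v = s /\ S v] (F v); last first.
    by move=> w [/F_inj <-].
  move: (LF v); move: (F v) => {v}.
  apply: (gallery_connected L_complex L_fin L_pure L_conn ow0) => [i le_in|e u e_flag Se Lu cmp].
    have [Li _] := flag0.1 (Ordinal (le_in : i < n.+1)%N).
    by exists (b (Ordinal (le_in : i < n.+1)%N)); split; rewrite // vertex_ofK.
  have [u' u'E] := F_onto u Lu; exists u'; split=> //.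
  apply: (Scl _ _ (flag_lift _ e_flag)) => [i|j ju].
    by have [w [<- Sw]] := Se i; rewrite F_vertex.
  apply/c_cmp; rewrite u'E vertex_ofK; last by case: (e_flag.1 j).
  by apply: cmp; rewrite -u'E -dE eqSS.
have [ex lower rank] :=
  typed_right_angled_group P (flag_lift _ flag0) E_uniq E_all gal d_inj.
have eN : (N - n - 1 = size E - n.+1)%N by rewrite sizeE; lia.
rewrite eN; split=> //.
by move=> H k _; apply: rank.
Qed.
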